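(* Let $V$ be a finite-dimensional real inner-product space, let $\Lambda\subset V$ be a closed additive subgroup, let $X=V/\Lambda$ carry the quotient metric, and let $\alpha\in X$ have strict best-return denominators $q_1<q_2<\cdots$. Let $\Lambda^\circ$ be the identity component of $\Lambda$ and put $r=\operatorname{rank}(\Lambda/\Lambda^\circ)$. If $r\ge1$, then $$q_{n+2^r}\ge q_n+q_{n+1}$$ for every $n\ge1$ for which the left-hand side is defined; consequently $g_N(\alpha)\le2^r+1$ for every integer $N\ge2$. If $r=0$, there is no strict best-return denominator after $q_1=1$, and $g_N(\alpha)\le1$ for every $N\ge2$.
   Context: The quotient metric on $X=V/\Lambda$ is $d_X(x,y)=\|x-y\|_X$ with $\|a+\Lambda\|_X=\inf_{\lambda\in\Lambda}\|a-\lambda\|_V$. Compactness of $X$ is not assumed. Best returns. For positive integers $q$ put $\rho(q)=d_X(q\alpha,0)$. The strict best-return denominators of $\alpha$ are $q_1=1$ and $q_{n+1}=\min\{q>q_n:\rho(q)<\rho(q_n)\}$ as long as such $q$ exists; the sequence may terminate, and a zero return (if any) is retained as its final term. Nearest-neighbour distances. For $N\ge2$ let $\mathcal O_N(\alpha)=\{0,\alpha,\dots,(N-1)\alpha\}$ as a set (repetitions discarded). If it has at least two points put $\delta_N(x)=\min_{y\in\mathcal O_N(\alpha),\,y\ne x}d_X(x,y)$ and $g_N(\alpha)=\#\{\delta_N(x):x\in\mathcal O_N(\alpha)\}$; if it is a singleton, $g_N(\alpha)=0$. *)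

(* Defs.v *)
From HB Require Import structures.
From mathcomp Require Import all_boot all_order all_algebra.
From mathcomp Require Import all_classical all_reals all_analysis.

Set Implicit Arguments.
Unset Strict Implicit.
Unset Printing Implicit Defensive.

Import Order.TTheory GRing.Theory Num.Theory numFieldNormedType.Exports.

Local Open Scope classical_set_scope.
Local Open Scope quotient_scope.
Local Open Scope ring_scope.

Notation "{ 'quot' I }" := (@Quotient.quot _ I) : type_scope.

(* The norm, hence the topology, is the one induced by the inner product;
   finite-dimensionality is the [Vector] structure. *)
HB.mixin Record NormedModule_hasInnerProduct (R : realType) V
    & NormedModule R V := {
  inner : {dot V for (@idfun R)};
  sqr_norm_inner : forall v : V, `|v| ^+ 2 = inner v v
}.

#[short(type="finInnerProductType")]
HB.structure Definition FinInnerProduct (R : realType) :=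
  {V of NormedModule R V & Vector R V & NormedModule_hasInnerProduct R V}.

Section AbelianRank.
Variable G : zmodType.

Definition zfree n (e : 'I_n -> G) : Prop :=
  forall c : 'I_n -> int, \sum_(i < n) e i *~ c i = 0 -> forall i, c i = 0.

Definition is_zrank (A : set G) (r : nat) : Prop :=
  (exists2 e : 'I_r -> G, (forall i, A (e i)) & zfree e) /\
  (forall n (e : 'I_n -> G), (forall i, A (e i)) -> zfree e -> (n <= r)%N).

(* Rank of a subgroup A of G: the largest size of a Z-independent family in A
   (with default value 0 if there are arbitrarily large ones). *)
Definition zrank (A : set G) : nat := xget 0%N [set r | is_zrank A r].

End AbelianRank.

Section IdentityComponent.
Variables (R : realType) (V : normedModType R) (L : zmodClosed V).

Definition idcomp : {pred V} :=
  [pred x | `[< connected_component [set` L] 0 x >]].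

Lemma idcomp_zmod_closed : zmod_closed idcomp.
Proof.
have L0 : [set` L] (0 : V) by rewrite /= rpred0.
split=> [|x y]; rewrite !inE; first exact: connected_component_refl.
move=> Cx Cy.
pose C := connected_component [set` L] (0 : V).
have CL : C `<=` [set` L] by exact: connected_component_sub.
have cont : {within C, continuous (fun z : V => x - z)}.
  apply: continuous_subspaceT => z.
  by apply: cvgB; [exact: cvg_cst | exact: cvg_id].
have conn : connected [set x - z | z in C].
  by apply: connected_continuous_connected cont; exact: component_connected.
apply: (connected_component_max _ _ conn).
- by exists x => //; rewrite subrr.
- move=> _ [z Cz <-] /=; apply: rpredB; [exact: (CL x)|exact: (CL z)].
- by exists y.
Qed.

HB.instance Definition _ :=
  GRing.isZmodClosed.Build V idcomp idcomp_zmod_closed.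

(* The group L / L°, as a subgroup of V / L°. *)
Definition component_group : set {quot idcomp} :=
  [set \pi_{quot idcomp} x | x in [set` L]].

End IdentityComponent.
Arguments component_group {R V} L.

Section QuotientMetric.
Variables (R : realType) (V : normedModType R) (L : zmodClosed V).
Local Notation X := {quot L}.

Definition qnorm (x : X) : R := inf [set `|repr x - l| | l in [set` L]].

Lemma qnorm_pi (a : V) : qnorm (\pi_X a) = inf [set `|a - l| | l in [set` L]].
Proof.
have La : repr (\pi_X a) - a \in L by rewrite Quotient.idealrBE reprK.
congr inf; apply/seteqP; split=> _ [l /= Ll <-].
  exists (l - (repr (\pi_X a) - a)); first by rewrite /= rpredB.
  by rewrite opprB addrCA addrA subrK addrC.
exists (l + (repr (\pi_X a) - a)); first by rewrite /= rpredD.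
by rewrite opprD opprB addrCA addrA addrACA subrr addr0 addrC.
Qed.

Definition qdist (x y : X) : R := qnorm (x - y).

Variable alpha : X.

Definition return_dist (q : nat) : R := qdist (alpha *+ q) 0.

(* [best_return n q]: the n-th strict best-return denominator (n >= 1) is
   defined and equal to q. *)
Inductive best_return : nat -> nat -> Prop :=
| best_return_first : best_return 1 1
| best_return_next n q q' :
    best_return n q ->
    (q < q')%N -> return_dist q' < return_dist q ->
    (forall p, (q < p)%N -> return_dist p < return_dist q -> (q' <= p)%N) ->
    best_return n.+1 q'.

Definition orbit_seg (N : nat) : seq X :=
  undup [seq alpha *+ k | k <- iota 0 N].

(* The infimum of a finite set, nonempty as soon as [orbit_seg N] has a point
   other than x: a minimum. *)
Definition nn_dist (N : nat) (x : X) : R :=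
  inf [set qdist x y | y in [set y | y \in orbit_seg N /\ y != x]].

Definition nn_count (N : nat) : nat :=
  if size (orbit_seg N) == 1%N then 0%N
  else size (undup [seq nn_dist N x | x <- orbit_seg N]).

End QuotientMetric.

(* Main.v *)
(* A vector v congruent to q alpha modulo L, together with q, is a point of an
   extension M of Z by L. Since the identity component of L is a linear
   subspace, hence divisible, L / 2L has at most 2 ^ r elements and M / 2M at
   most 2 ^ (r + 1). Take the points (v_q, q) with v_q an almost shortest lift,
   for strict best returns q of which no one is at least the sum of two others.
   They are nonzero and distinct modulo 2M, as one could otherwise halve a point
   or a difference. If three of them, i < j < k, had a sum in 2M, say 2t, then
   t - v_i, t - v_j, t - v_k would be lifts of smaller multiples of alpha, hence
   longer than v_j, v_i, v_i; but the sum of their squared lengths is at most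
   |v_i|^2 + |v_j|^2 + |v_k|^2. So these points form a sum-free set in M / 2M,
   of size at most 2 ^ r. This applies to q_n, ..., q_(n + 2 ^ r), and to the
   best returns in the interval (N / 2, N - 1], which bound the number of
   nearest-neighbour distances because the distance at k alpha is the minimum of
   the return distances up to max(k, N - 1 - k). *)
Require Import Defs.
From HB Require Import structures.
From mathcomp Require Import all_boot all_order all_algebra.
From mathcomp Require Import all_classical all_reals all_analysis.
From mathcomp Require Import zify lra.

Import Order.TTheory GRing.Theory Num.Theory numFieldNormedType.Exports.

Local Open Scope classical_set_scope.
Local Open Scope quotient_scope.
Local Open Scope ring_scope.

Set Implicit Arguments.
Unset Strict Implicit.
Unset Printing Implicit Defensive.

(** * Closed subgroups *)

Lemma closed_approx (R : realType) (V : normedModType R) (A : set V) (x : V) :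
  closed A -> (forall d : R, 0 < d -> exists2 y, A y & `|x - y| < d) -> A x.
Proof.
move=> clA H; apply: clA => B /nbhs_ballP[d /= d0 dB].
have [y Ay xy] := H _ d0; exists y; split=> //.
by apply: dB; rewrite -ball_normE.
Qed.

Section ClosedSubgroups.
Variables (R : realType) (V : finInnerProductType R) (L : zmodClosed V).

(** Rounding down the coordinates of [x] along [X] changes each of them by less than 1. *)
Lemma span_floor_approx (X : seq V) (x : V) :
  {subset X <= L} -> x \in <<X>>%VS ->
  exists2 l, l \in L & `|x - l| <= \sum_(v <- X) `|v|.
Proof.
move=> XL Xx; pose c i : R := coord (in_tuple X) i x.
exists (\sum_(i < size X) X`_i *~ Num.floor (c i)).
  by apply: rpred_sum => i _; rewrite rpredMz// XL// mem_nth.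
rewrite (coord_span (X := in_tuple X) Xx) -sumrB (big_nth 0) big_mkord.
apply: (le_trans (ler_norm_sum _ _ _)); apply: ler_sum => i _.
rewrite -scaler_int -scalerBl normrZ ler_piMl//.
have := floor_le (c i); have := floorD1_gt (c i); rewrite intrD -/(c i).
by rewrite ler_norml; lra.
Qed.

(* W is the span of the elements of L in a ball so small that the dimension of
   this span has become stationary: every point of W is then at arbitrarily
   small distance from L. *)
Lemma closed_subgroup_locally_linear : closed [set` L] ->
  exists2 W : {vspace V}, {subset W <= L} &
    exists2 e : R, 0 < e & forall x, x \in L -> `|x| < e -> x \in W.
Proof.
move=> clL.
pose short (e : R) (X : seq V) := forall v : V, v \in X -> v \in L /\ `|v| < e.
pose Q (d : nat) := exists2 e : R, 0 < e & forall X, short e X -> free X -> (size X <= d)%N.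
have exQ : exists d, `[< Q d >].
  exists (\dim {:V}); apply/asboolP; exists 1 => // X _ /eqP <-.
  exact/dimvS/subvf.
case: (ex_minnP exQ) => d /asboolP[e e0 He] dmin.
have ext X : short e X -> free X -> size X = d ->
    forall x, x \in L -> `|x| < e -> x \in <<X>>%VS.
  move=> sX fX sz x Lx xe; apply/negPn/negP => nx.
  suff : (size (x :: X) <= d)%N by rewrite /= sz ltnn.
  apply: He; last by rewrite free_cons nx.
  by move=> v; rewrite inE => /predU1P[->|/sX].
(* Minimality of [d] forces free families of size [d] in every smaller ball; the choice of [e]
   forbids larger ones. *)
have exX e' : 0 < e' -> e' <= e ->
    exists X, [/\ short e' X, free X & size X = d].
  move=> e'0 e'e; case: d {ext} He dmin => [|d] He dmin.
    by exists [::]; split=> //; rewrite nil_free.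
  have /asboolPn nQ : ~~ `[< Q d >] by apply/negP => /dmin; rewrite ltnn.
  have [X sX [fX szX]] : exists2 X, short e' X & free X /\ (d < size X)%N.
    apply: contrapT => nX; apply: nQ; exists e' => // X sX fX.
    by rewrite leqNgt; apply/negP => ?; apply: nX; exists X.
  exists X; split=> //; apply/eqP; rewrite eqn_leq szX andbT He// => v /sX[? ?].
  by split=> //; exact: lt_le_trans e'e.
have [X0 [sX0 fX0 szX0]] := exX e e0 (lexx e).
exists <<X0>>%VS; last by exists e => //; exact: ext.
move=> x X0x; apply: (closed_approx clL) => r r0.
(* Rounding against [d] vectors shorter than [e'] costs at most [d * e'], which is below [r]. *)
pose e' := Num.min e (r / d.+1%:R).
have e'0 : 0 < e' by rewrite lt_min e0 divr_gt0.
have e'e : e' <= e by rewrite ge_min lexx.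
have [X [sX fX szX]] := exX e' e'0 e'e.
have spanX : <<X>>%VS = <<X0>>%VS.
  apply/eqP; rewrite -(dimv_leqif_eq _); last first.
    apply/span_subvP => v /sX[Lv ve]; apply: ext => //.
    exact: lt_le_trans e'e.
  by rewrite (eqP fX) (eqP fX0) szX szX0.
have XL : {subset X <= L} by move=> v /sX[].
have [|l Ll xl] := span_floor_approx (x := x) XL; first by rewrite spanX.
exists l => //; apply: le_lt_trans xl _.
apply: (@le_lt_trans _ _ (\sum_(v <- X) e')).
  by rewrite big_seq [leRHS]big_seq; apply: ler_sum => v /sX[_ /ltW].
rewrite big_const_seq count_predT szX iter_addr_0 -mulr_natr.
apply: (@le_lt_trans _ _ (r / d.+1%:R * d%:R)).
  by rewrite ler_wpM2r// ge_min lexx orbT.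
by rewrite mulrAC ltr_pdivrMr// ltr_pM2l// ltr_nat.
Qed.

(** * The identity component of a closed subgroup, and the rank of the component group *)

Lemma idcomp_sub : {subset idcomp L <= L}.
Proof.
by move=> x; rewrite inE => Cx; exact: (connected_component_sub Cx).
Qed.

(** The line through [x] is connected, passes through 0 and stays in [L]. *)
Lemma subspace_sub_idcomp (W : {vspace V}) :
  {subset W <= L} -> {subset W <= idcomp L}.
Proof.
move=> WL x Wx; rewrite inE.
have cont : {within [set: R], continuous (fun t : R => t *: x)}.
  by apply: continuous_subspaceT => t; exact: scalel_continuous.
have conn : connected [set t *: x | t in [set: R]].
  apply: connected_continuous_connected cont.
  by apply/connected_intervalP => ? ? _ _ ? _.
apply: (connected_component_max _ _ conn).
- by exists 0 => //; rewrite scale0r.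
- by move=> _ [t _ <-] /=; apply/WL/memvZ.
- by exists 1 => //; rewrite scale1r.
Qed.

(** Points of [L] at distance less than [e] lie in the same coset of [W], so [W] cuts out a
    relatively open and closed part of the component of 0. *)
Lemma idcomp_sub_subspace (W : {vspace V}) (e : R) :
  {subset W <= L} -> 0 < e ->
  (forall x, x \in L -> `|x| < e -> x \in W) -> {subset idcomp L <= W}.
Proof.
move=> WL e0 We x; rewrite inE => Cx.
pose C := connected_component [set` L] (0 : V).
have CL y : C y -> y \in L by move=> Cy; exact: (connected_component_sub Cy).
have sameW y z : y \in L -> z \in L -> ball z e y -> (y \in W) = (z \in W).
  rewrite -ball_normE /= distrC => Ly Lz yz.
  have Wyz : y - z \in W by apply: We; rewrite ?rpredB// distrC.
  by rewrite -[in LHS](subrK z y) rpredDl.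
pose nearset (P : pred V) := \bigcup_(y in [set y | y \in L /\ P y]) ball y e.
have nearO P : open (nearset P) by apply: bigcup_open => y _; exact: ball_open.
have nearC y (P : pred V) : y \in L -> P y -> nearset P y.
  by move=> Ly Py; exists y => //; exact: ballxx.
have CW : C `&` [set` W] = C.
  apply: component_connected.
  - exists 0; split; last exact: mem0v.
    have L0 : [set` L] (0 : V) by rewrite /= rpred0.
    exact: connected_component_refl L0.
  - exists (nearset (mem W)) => //; apply/seteqP; split=> y [Cy].
      by move=> Wy; split=> //; exact: (nearC y (mem W) (CL y Cy) Wy).
    by move=> [z [Lz Wz] zy]; split=> //=; rewrite (sameW y z (CL y Cy) Lz zy).
  - exists (~` nearset [predC W]); first exact: open_closedC.
    apply/seteqP; split=> y [Cy] => [Wy|nWy]; split=> //.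
      by move=> [z [Lz /negP nWz] zy]; apply: nWz; rewrite -(sameW y z (CL y Cy) Lz zy).
    by apply: contrapT => /negP ?; apply: nWy; exact: (nearC y [predC W] (CL y Cy)).
by have : C x by []; rewrite -CW => -[].
Qed.

Hypothesis closedL : closed [set` L].

Lemma idcompZ (a : R) (x : V) : x \in idcomp L -> a *: x \in idcomp L.
Proof.
have [W WL [e e0 We]] := closed_subgroup_locally_linear closedL.
move=> /(idcomp_sub_subspace WL e0 We) Wx.
by apply: (subspace_sub_idcomp WL); exact: memvZ.
Qed.

Lemma idcomp_open_in : exists2 e : R, 0 < e &
  forall x, x \in L -> `|x| < e -> x \in idcomp L.
Proof.
have [W WL [e e0 We]] := closed_subgroup_locally_linear closedL.
by exists e => // x Lx /(We _ Lx); exact: subspace_sub_idcomp.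
Qed.

(* Dirichlet's simultaneous approximation: integer multiples of a real relation
   between the [u i] give, after taking integer parts, nontrivial integer
   combinations of the [u i] which are arbitrarily short. *)
Lemma indep_mod_idcomp_le_dim n (u : 'I_n -> V) : (forall i, u i \in L) ->
  (forall c : 'I_n -> int, \sum_i u i *~ c i \in idcomp L -> forall i, c i = 0) ->
  (n <= \dim {:V})%N.
Proof.
move=> Lu indep; rewrite leqNgt; apply/negP => dn.
have [e e0 He] := idcomp_open_in.
(* Normalising one coefficient to 1 makes the integer relation below nontrivial: its [k]-th
   coefficient is [m - m']. *)
have [t [k [tk tu]]] :
    exists (t : 'I_n -> R) k, t k = 1 /\ \sum_i t i *: u i = 0.
  have /freeP nfree : ~~ free (mktuple u).
    by rewrite /free size_tuple neq_ltn (leq_ltn_trans _ dn)// dimvS// subvf.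
  have [t [k [tk tu]]] :
      exists (t : 'I_n -> R) k, t k != 0 /\ \sum_i t i *: u i = 0.
    apply: contrapT => nt; apply: nfree => t tu i.
    apply: contrapT => /eqP ti; apply: nt; exists t, i; split=> //.
    by rewrite -[RHS]tu; apply: eq_bigr => j _; rewrite -tnth_nth tnth_mktuple.
  exists (fun i => (t k)^-1 * t i), k; rewrite mulVf//; split=> //.
  by under eq_bigr do rewrite -scalerA; rewrite -scaler_sumr tu scaler0.
have [N HN] : exists N, \sum_i `|u i| < N.+1%:R * e.
  exists (Num.truncn ((\sum_i `|u i|) / e)).
  by rewrite -ltr_pdivrMr//; exact: truncnS_gt.
pose fr (m : nat) i := m%:R * t i - (Num.floor (m%:R * t i))%:~R.
have fr01 m i : 0 <= N.+1%:R * fr m i < N.+1%:R.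
  have := floor_le (m%:R * t i); have := floorD1_gt (m%:R * t i).
  rewrite /fr intrD => h1 h2; rewrite mulr_ge0 ?subr_ge0//=.
  by rewrite gtr_pMr ?ltr0n//; lra.
(* Pigeonhole: [N.+1 ^ n + 1] multiples of [t], reduced modulo 1, fall into [N.+1 ^ n] cubes of side
   [1 / N.+1]. *)
pose cell (m : 'I_(N.+1 ^ n).+1) : {ffun 'I_n -> 'I_N.+1} :=
  [ffun i => inord (Num.truncn (N.+1%:R * fr m i))].
have [m [m' [mm' cmm']]] : exists m m', m != m' /\ cell m = cell m'.
  apply: contrapT => ncell.
  suff /leq_card : injective cell by rewrite card_ffun !card_ord ltnn.
  move=> m m' cmm'; apply: contrapT => /eqP mm'.
  by apply: ncell; exists m, m'.
have frd i : `|fr m i - fr m' i| * N.+1%:R < 1.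
  have trN p : (Num.truncn (N.+1%:R * fr p i) < N.+1)%N.
    have /andP[ge0 ltN] := fr01 p i.
    by rewrite -(ltr_nat R); apply: le_lt_trans ltN; rewrite truncn_le.
  move/ffunP/(_ i)/(congr1 val) : cmm'; rewrite !ffunE /= !inordK// => trE.
  have /andP[/truncn_itv h _] := fr01 m i.
  have /andP[/truncn_itv h' _] := fr01 m' i.
  move: h h'; rewrite trE => /andP[h1 h2] /andP[h3 h4].
  rewrite -[X in _ * X < _](ger0_norm (ler0n _ _)) -normrM mulrBl.
  rewrite ![_ * N.+1%:R]mulrC ltr_norml -natr1 in h1 h2 h3 h4 *.
  by lra.
pose c i := Num.floor (m%:R * t i) - Num.floor (m'%:R * t i).
have sumc : \sum_i u i *~ c i = - (\sum_i (fr m i - fr m' i) *: u i).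
  have tu0 : (m%:R - m'%:R) *: (\sum_i t i *: u i) = 0 by rewrite tu scaler0.
  rewrite -[LHS]subr0 -[X in _ - X]tu0 scaler_sumr -sumrB -sumrN; apply: eq_bigr => i _.
  rewrite -scaler_int scalerA -scalerBl -[RHS]scaleNr; congr (_ *: _).
  by rewrite /c /fr intrB mulrBl; lra.
have := indep c; rewrite sumc => /(_ _ k).
rewrite /c tk !mulr1 !pmulrn !intrKfloor => c0.
have {c0} /c0 : - (\sum_i (fr m i - fr m' i) *: u i) \in idcomp L.
  apply: He; first by rewrite -sumc rpred_sum// => i _; rewrite rpredMz.
  rewrite normrN (le_lt_trans (ler_norm_sum _ _ _))//.
  rewrite -(ltr_pM2l (ltr0Sn R N)); apply: le_lt_trans HN.
  rewrite mulr_sumr; apply: ler_sum => i _.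
  by rewrite normrZ mulrA ler_piMl// mulrC ltW.
by move/eqP; rewrite subr_eq0 eqz_nat => /eqP/val_inj/eqP; exact/negP.
Qed.

(** The default value 0 of [zrank] must be ruled out: the dimension bound, applied to lifts of free
    families, makes [zrank] a true maximum. *)
Lemma indep_mod_idcomp_le_zrank n (u : 'I_n -> V) : (forall i, u i \in L) ->
  (forall c : 'I_n -> int, \sum_i u i *~ c i \in idcomp L -> forall i, c i = 0) ->
  (n <= zrank (component_group L))%N.
Proof.
pose free_size n := exists2 u : 'I_n -> {quot (idcomp L)},
    (forall i, component_group L (u i)) & zfree u.
have sum_pi m (v : 'I_m -> V) (c : 'I_m -> int) :
    (\sum_i \pi_{quot (idcomp L)} (v i) *~ c i == 0) =
    (\sum_i v i *~ c i \in idcomp L).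
  have -> : \sum_i \pi_{quot (idcomp L)} (v i) *~ c i =
            \pi_{quot (idcomp L)} (\sum_i v i *~ c i).
    by rewrite raddf_sum; apply: eq_bigr => i _; rewrite raddfMz.
  by rewrite -[X in X \in _]subr0 Quotient.idealrBE raddf0.
move=> Lu indep.
have ubS m : free_size m -> (m <= \dim {:V})%N.
  move=> [w Lw freew]; pose v i := sval (cid2 (Lw i)).
  have vE i : \pi_{quot (idcomp L)} (v i) = w i by rewrite /v; case: cid2.
  have Lv i : v i \in L by rewrite /v; case: cid2.
  apply: (indep_mod_idcomp_le_dim Lv) => c; rewrite -sum_pi => /eqP c0 i.
  by apply: freew; rewrite -[RHS]c0; apply: eq_bigr => j _; rewrite vE.
have exS : exists m, `[< free_size m >].
  exists n; apply/asboolP; exists (fun i => \pi_{quot (idcomp L)} (u i)) => [i|c].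
    by exists (u i); [exact: Lu | reflexivity].
  by move/eqP; rewrite sum_pi; exact: indep.
have ubS' m : `[< free_size m >] -> (m <= \dim {:V})%N by move/asboolP/ubS.
have : is_zrank (component_group L) (zrank (component_group L)).
  rewrite /zrank; apply: xgetPex.
  case: (ex_maxnP exS ubS') => m /asboolP[w Lw freew] maxm.
  by exists m; split; [exists w | move=> p x Lx freex; apply/maxm/asboolP; exists x].
case=> _; apply; first by move=> i; exists (u i); [exact: Lu | reflexivity].
by move=> c /eqP; rewrite sum_pi; exact: indep.
Qed.

(** * Classes of [L] modulo [2L] *)

Definition double_in (x : V) : Prop := exists2 m, m \in L & x = m *+ 2.

Lemma double_inB x y : double_in x -> double_in y -> double_in (x - y).
Proof.
by move=> [m Lm ->] [p Lp ->]; exists (m - p); rewrite ?rpredB// mulrnBl.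
Qed.

Lemma idcomp_double x :
  x \in idcomp L -> exists2 m, m \in idcomp L & x = m *+ 2.
Proof.
move=> Cx; exists (2^-1 *: x); first exact: idcompZ.
by rewrite scalerMnl -mulr_natr mulVf ?pnatr_eq0// scale1r.
Qed.

(* As [idcomp L] is divisible by 2, all coefficients of a relation modulo
   [idcomp L] are even, and the relation can be halved again and again. *)
Lemma indep_mod2_indep n (u : 'I_n -> V) : (forall i, u i \in L) ->
  (forall b : 'I_n -> bool, double_in (\sum_i u i *+ b i) -> forall i, b i = false) ->
  forall c : 'I_n -> int, \sum_i u i *~ c i \in idcomp L -> forall i, c i = 0.
Proof.
move=> Lu indep.
have halve (c : 'I_n -> int) : \sum_i u i *~ c i \in idcomp L ->
    (forall i, c i = (c i %/ 2)%Z * 2) /\ \sum_i u i *~ (c i %/ 2)%Z \in idcomp L.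
  move=> Cc; have [m Cm cm] := idcomp_double Cc.
  pose b i := odd `|c i|.
  pose h i := (c i %/ 2)%Z.
  have cE i : c i = h i * 2 + (b i)%:Z by rewrite /h /b; lia.
  have sumE : \sum_i u i *~ c i = (\sum_i u i *~ h i) *+ 2 + \sum_i u i *+ b i.
    rewrite -sumrMnl -big_split; apply: eq_bigr => i _ /=.
    by rewrite {1}cE mulrzDr mulrzA.
  have b0 : forall i, b i = false.
    apply: indep; exists (m - \sum_i u i *~ h i).
      rewrite rpredB ?(idcomp_sub Cm)// rpred_sum// => i _.
      by rewrite rpredMz.
    by rewrite mulrnBl -cm sumE addrC addKr.
  split=> [i|]; first by rewrite {1}cE b0 addr0.
  suff -> : \sum_i u i *~ h i = m by [].
  have : (\sum_i u i *~ h i) *+ 2 = m *+ 2.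
    by rewrite -cm sumE [X in _ + X]big1 ?addr0// => i _; rewrite b0.
  move=> /(congr1 (fun z => 2^-1 *: z)).
  by rewrite -!scalerMnr !scalerMnl -mulr_natr mulVf ?pnatr_eq0// !scale1r.
have dvd k (c : 'I_n -> int) : \sum_i u i *~ c i \in idcomp L ->
    exists d : 'I_n -> int, forall i, c i = d i * 2 ^+ k.
  elim: k c => [|k IH] c Cc; first by exists c => i; rewrite mulr1.
  have [cE /IH[d dE]] := halve c Cc.
  by exists d => i; rewrite exprSr mulrA -dE -cE.
(* The coefficient is divisible by 2 to the power of its own absolute value, a number exceeding that
   absolute value; so it is 0. *)
move=> c Cc i; have [d /(_ i) cE] := dvd `|c i|%N c Cc.
have absE : `|c i|%N = (`|d i| * 2 ^ `|c i|)%N by rewrite {1}cE abszM abszX.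
have [d0|dN0] := eqVneq (d i) 0; first by rewrite cE d0 mul0r.
have := ltn_expl `|c i| (isT : (1 < 2)%N); rewrite [X in (X < _)%N]absE.
by rewrite ltnNge leq_pmull// absz_gt0.
Qed.

(** A maximal family of [L] independent modulo [2L] spans [L / 2L] over the field with two elements;
    its size is at most the rank, and [cls] records the coordinates. *)
Lemma mod2_classes : exists (T : finType) (cls : V -> T),
  (#|T| <= 2 ^ zrank (component_group L))%N /\
  forall x y, x \in L -> y \in L -> cls x = cls y -> double_in (x - y).
Proof.
(* Indexing by [nat] lets a family be extended by one vector without changing its type. *)
pose P n (u : nat -> V) := (forall i, u i \in L) /\
  forall b : nat -> bool, double_in (\sum_(i < n) u i *+ b i) ->
  forall i, (i < n)%N -> b i = false.
have exP : exists n, `[< exists u, P n u >].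
  exists 0%N; apply/asboolP; exists (fun=> 0); split=> // i; exact: rpred0.
have ubP n : `[< exists u, P n u >] -> (n <= zrank (component_group L))%N.
  move=> /asboolP[u [Lu indep]].
  apply: (@indep_mod_idcomp_le_zrank n (fun i => u i)) => //.
  apply: indep_mod2_indep => // b db i.
  pose b' j := if insub j is Some k then b k else false.
  have b'E (j : 'I_n) : b' j = b j by rewrite /b' valK.
  rewrite -b'E; apply: (indep b') => //.
  by under eq_bigr do rewrite b'E.
case: (ex_maxnP exP ubP) => n /asboolP[u [Lu indep]] maxn.
have ex x : x \in L -> exists b : {ffun 'I_n -> bool},
    double_in (x - \sum_(i < n) u i *+ b i).
  move=> Lx; pose u' i := if (i < n)%N then u i else x.
  have sumu' (b : nat -> bool) : \sum_(i < n.+1) u' i *+ b i =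
      \sum_(i < n) u i *+ b i + x *+ b n.
    rewrite big_ord_recr /= {2}/u' ltnn; congr (_ + _).
    by apply: eq_bigr => i _; rewrite /u' ltn_ord.
  have [b [db [k kn bk]]] : exists b : nat -> bool,
      double_in (\sum_(i < n.+1) u' i *+ b i) /\
      exists2 k, (k < n.+1)%N & b k.
    apply: contrapT => nb; suff : (n.+1 <= n)%N by rewrite ltnn.
    apply/maxn/asboolP; exists u'; split=> [i|b db i ni].
      by rewrite /u'; case: ifP.
    by apply/negbTE/negP => bi; apply: nb; exists b; split=> //; exists i.
  rewrite sumu' in db.
  have bn : b n.
    apply/negPn/negP => /negbTE bn; rewrite bn addr0 in db.
    have := indep b db k; move: kn; rewrite ltnS leq_eqVlt => /predU1P[kE|kn].
      by rewrite kE bn in bk.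
    by rewrite bk => /(_ kn).
  exists [ffun i : 'I_n => b i]; under eq_bigr do rewrite ffunE.
  rewrite bn in db; set s := \sum_(i < n) _ in db *.
  (* The relation puts [s + x] in [2L], and [x - s] differs from it by twice an element of [L]. *)
  rewrite (_ : x - s = s + x - s *+ 2); last by rewrite mulr2n opprD addrA (addrC s) addrK.
  apply: double_inB => //; exists s => //.
  by rewrite /s rpred_sum// => i _; rewrite rpredMn.
have exc x : exists b : {ffun 'I_n -> bool}, x \in L ->
    double_in (x - \sum_(i < n) u i *+ b i).
  have [/ex[b]|_] := boolP (x \in L); first by exists b.
  by exists [ffun=> false].
have [cls clsP] := choice exc.
exists {ffun 'I_n -> bool}, cls; split.
  rewrite card_ffun card_ord card_bool leq_exp2l// ubP//.
  by apply/asboolP; exists u.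
move=> x y Lx Ly xy; have := double_inB (clsP x Lx) (clsP y Ly).
by rewrite xy opprB addrA subrK.
Qed.

End ClosedSubgroups.
(** * Return distances *)

Section QuotientNorm.
Variables (R : realType) (V : normedModType R) (L : zmodClosed V).
Local Notation X := {quot L}.

Lemma qnorm_has_inf (a : V) : has_inf [set `|a - l| | l in [set` L]].
Proof.
split; first by exists `|a - 0|, 0 => //=; exact: rpred0.
by exists 0 => _ [l _ <-]; exact: normr_ge0.
Qed.

Lemma qnorm_le (a l : V) : l \in L -> qnorm (\pi_X a) <= `|a - l|.
Proof.
move=> Ll; rewrite qnorm_pi; apply: ge_inf; last by exists l.
exact: (qnorm_has_inf a).2.
Qed.

Lemma qnorm_approx (a : V) (e : R) : 0 < e ->
  exists2 l, l \in L & `|a - l| < qnorm (\pi_X a) + e.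
Proof.
move=> e0; rewrite qnorm_pi.
by have [_ [l Ll <-] lt] := inf_adherent e0 (qnorm_has_inf a); exists l.
Qed.

Lemma qnormN (x : X) : qnorm (- x) = qnorm x.
Proof.
rewrite -(reprK x) -raddfN !qnorm_pi; congr inf.
by apply/seteqP; split=> _ [l /= Ll <-]; exists (- l);
   rewrite /= ?rpredN// -opprD normrN // opprK.
Qed.

Lemma qdistC (x y : X) : qdist x y = qdist y x.
Proof. by rewrite /qdist -qnormN opprB. Qed.

Variable alpha : X.

Lemma return_distE q : return_dist alpha q = qnorm (\pi_X (repr alpha *+ q)).
Proof. by rewrite /return_dist /qdist subr0 -[in LHS](reprK alpha) -raddfMn. Qed.

Lemma qdist_multiples i j : (i <= j)%N ->
  qdist (alpha *+ i) (alpha *+ j) = return_dist alpha (j - i).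
Proof.
by move=> ij; rewrite qdistC /return_dist /qdist subr0 mulrnBr.
Qed.

Definition strict_return q : Prop :=
  (0 < q)%N /\ forall p, (0 < p)%N -> (p < q)%N ->
    return_dist alpha q < return_dist alpha p.

End QuotientNorm.

(** Expanding the squares, the right side exceeds the left by exactly the squared norm of [t]. *)
Lemma sum_sqr_norm_half (R : realType) (V : finInnerProductType R) (t x y z : V) :
  t *+ 2 = x + y + z ->
  `|t - x| ^+ 2 + `|t - y| ^+ 2 + `|t - z| ^+ 2 <=
  `|x| ^+ 2 + `|y| ^+ 2 + `|z| ^+ 2.
Proof.
move=> txyz.
have sqB u v : `|u - v| ^+ 2 = `|u| ^+ 2 - inner u v *+ 2 + `|v| ^+ 2 :> R.
  rewrite !sqr_norm_inner linearBl !linearBr /=.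
  by rewrite [inner v u]hermC expr0 mul1r /=; lra.
have innerE : inner t x + inner t y + inner t z = `|t| ^+ 2 *+ 2 :> R.
  by rewrite -!linearDr -txyz linearMnr sqr_norm_inner.
by have := sqr_ge0 `|t|; rewrite !sqB; lra.
Qed.

Lemma seq_pos_lbound (R : realType) (s : seq R) : (forall x, x \in s -> 0 < x) ->
  exists2 e : R, 0 < e & forall x, x \in s -> e <= x.
Proof.
elim: s => [|y s IH] pos; first by exists 1.
have [x xs|e e0 He] := IH; first by apply: pos; rewrite inE xs orbT.
exists (Num.min y e); first by rewrite lt_min e0 pos// mem_head.
by move=> x; rewrite inE => /predU1P[->|/He ex]; rewrite ge_min ?lexx ?ex ?orbT.
Qed.

(** * Counting strict returns by their classes modulo 2 *)

Section Returns.
Variables (R : realType) (V : finInnerProductType R) (L : zmodClosed V).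
Hypothesis closedL : closed [set` L].
Variable alpha : {quot L}.
Local Notation rho := (return_dist alpha).

(** The condition on sums excludes triples with sum in [2M], the one on [i + p * 2] excludes pairs
    congruent modulo [2M]. The latter compares return distances instead of asking [p < i], because
    for [i = q_n] the half-difference [p] may lie between [q_n] and [q_{n+1}]. *)
Lemma strict_returns_card (s : seq nat) : uniq s ->
  (forall q, q \in s -> strict_return alpha q) ->
  (forall i j k, i \in s -> j \in s -> k \in s -> i != j -> (k < i + j)%N) ->
  (forall i p, i \in s -> (i + p * 2)%N \in s -> (0 < p)%N -> rho i <= rho p) ->
  (size s <= 2 ^ zrank (component_group L))%N.
Proof.
move=> us rets addlt pairlt.
(* The tolerance [e] is at most half of every gap [rho p - rho q], so lifts shorter than [rho q + e]
   still compare strictly as shortest lifts would. *)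
have [e e0 He] : exists2 e : R, 0 < e & forall q p, q \in s -> (0 < p)%N ->
    (p < q)%N -> rho q + e *+ 2 <= rho p.
  pose gaps := [seq (rho p - rho q) / 2 | q <- s, p <- iota 1 q.-1].
  have [|e e0 He] := @seq_pos_lbound R gaps.
    move=> x /allpairsPdep[q [p [qs]]]; rewrite mem_iota => /andP[p0 pq] ->.
    have [q0 /(_ p) lt] := rets q qs.
    by rewrite divr_gt0// subr_gt0; apply: lt; lia.
  exists e => // q p qs p0 pq.
  have : e <= (rho p - rho q) / 2.
    apply/He/allpairsPdep; exists q, p; split=> //.
    by rewrite mem_iota; lia.
  lra.
have [l Hl] : exists l : nat -> V, forall q, l q \in L /\
    `|repr alpha *+ q - l q| < rho q + e.
  suff /choice[l Hl] : forall q, exists l, l \in L /\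
    `|repr alpha *+ q - l| < rho q + e by exists l.
  move=> q; rewrite return_distE.
  by have [l Ll lt] := qnorm_approx L (repr alpha *+ q) e0; exists l.
have Ll q : l q \in L by case: (Hl q).
pose w p m : V := repr alpha *+ p - m.
pose v q := w q (l q).
have rho_le p m : m \in L -> rho p <= `|w p m|.
  by move=> Lm; rewrite return_distE; exact: qnorm_le.
have vlt q p m : q \in s -> (0 < p)%N -> (p < q)%N -> m \in L ->
    `|v q| < `|w p m|.
  move=> qs p0 pq Lm; have := He q p qs p0 pq; have := rho_le p m Lm.
  have [_] := Hl q; rewrite -/(w q (l q)) -/(v q); lra.
have vdec i k : i \in s -> k \in s -> (i < k)%N -> `|v k| < `|v i|.
  by move=> si sk ik; apply: vlt => //; have [] := rets i si.
have nzero q : q \in s -> double_in L (l q) -> ~~ odd q -> False.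
  move=> qs [m Lm lqm] oq; have [q0 _] := rets q qs.
  have := vlt q q./2 m qs _ _ Lm.
  have -> : v q = w q./2 m *+ 2.
    by rewrite /v /w lqm mulrnBl -mulrnA; congr (_ *+ _ - _); lia.
  have q20 : (0 < q./2)%N by lia.
  have q2q : (q./2 < q)%N by lia.
  by rewrite normrMn => /(_ q20 q2q); have := normr_ge0 (w q./2 m); lra.
have npair i k : i \in s -> k \in s -> (i < k)%N -> double_in L (l k - l i) ->
    odd i = odd k -> False.
  move=> si sk ik [m Lm lm] oik.
  have [p kE] : exists p, k = (i + p * 2)%N by exists (k - i)./2; lia.
  have p0 : (0 < p)%N by lia.
  have := pairlt i p si; rewrite -kE => /(_ sk p0).
  have := rho_le p m Lm; have [i0 _] := rets i si; have := He k i sk i0 ik.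
  (* Hence [2 rho p <= |v k| + |v i| < rho k + rho i + 2e <= 2 rho i], against [rho i <= rho p]. *)
  have : `|w p m| *+ 2 <= `|v k| + `|v i|.
    rewrite -normrMn; apply: le_trans (ler_normB _ _).
    suff -> : w p m *+ 2 = v k - v i by [].
    rewrite /v /w mulrnBl -lm -mulrnA [X in _ = _ *+ X - _ - _]kE mulrnDr.
    rewrite !opprB (addrC (_ *+ i)) -!addrA; congr (_ + _).
    by rewrite [RHS]addrCA [X in _ = _ + X]addrC subrK addrC.
  have [_ ] := Hl i; have [_ ] := Hl k; rewrite -!/(w _ (l _)) -!/(v _).
  lra.
have ntriple i j k : i \in s -> j \in s -> k \in s -> (i < j)%N -> (j < k)%N ->
    double_in L (l i + l j + l k) -> ~~ odd (i + j + k) -> False.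
  move=> si sj sk ij jk [m Lm lm] oijk.
  (* This places [h - i], [h - j], [h - k] strictly between 0 and [j], [i], [i] respectively. *)
  have kij : (k < i + j)%N by apply: addlt => //; lia.
  have [h hE] : exists h, (i + j + k)%N = (h * 2)%N by exists (i + j + k)./2; lia.
  have t2 : w h m *+ 2 = v i + v j + v k.
    rewrite /v /w mulrnBl -lm -mulrnA -hE !mulrnDr.
    by rewrite (addrACA (_ *+ i)) (addrACA (_ + _)) !opprD.
  have tB x : (x <= h)%N -> w h m - v x = w (h - x)%N (m - l x).
    move=> xh; rewrite /v /w mulrnBr// !opprB [LHS]addrACA [RHS]addrACA.
    by rewrite (addrC (- m)).
  have := sum_sqr_norm_half t2; rewrite !tB; [|lia..].
  have sq (x y : V) : `|x| < `|y| -> `|x| ^+ 2 < `|y| ^+ 2.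
    by move=> xy; rewrite ltr_pXn2r// nnegrE.
  have Lml x : m - l x \in L by rewrite rpredB.
  have h1 : `|v j| < `|w (h - i)%N (m - l i)| by apply: vlt => //; lia.
  have h2 : `|v i| < `|w (h - j)%N (m - l j)| by apply: vlt => //; lia.
  have h3 : `|v i| < `|w (h - k)%N (m - l k)| by apply: vlt => //; lia.
  have := sq _ _ h1; have := sq _ _ h2; have := sq _ _ h3.
  have := sq _ _ (vdec i k si sk (ltn_trans ij jk)).
  lra.
have triple (c : seq nat) : size c = 3%N -> uniq c -> {subset c <= s} ->
    double_in L (\sum_(q <- c) l q) -> ~~ odd (\sum_(q <- c) q) -> False.
  have pc := permEl (perm_sort leq c).
  rewrite -(perm_size pc) -(sort_uniq leq) -!(perm_big _ pc)/= => sz uc cs.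
  have {cs} : {subset sort leq c <= s} by move=> q; rewrite mem_sort; exact: cs.
  have : sorted ltn (sort leq c) by rewrite ltn_sorted_uniq_leq uc sort_sorted.
  case: (sort leq c) sz => [|i [|j [|k []]]]//= _ /and3P[ij jk _] cs.
  rewrite !big_cons !big_nil !addr0 !addrA addn0 addnA.
  by apply: ntriple => //; apply: cs; rewrite !inE eqxx ?orbT.
have [T [cls [cardT clsP]]] := mod2_classes closedL.
have pair i k : i \in s -> k \in s -> i != k -> double_in L (l i - l k) ->
    odd i = odd k -> False.
  move=> si sk; case: (ltngtP i k) => // ik _ [m Lm lm] oik.
    apply: (npair i k) => //; exists (- m); rewrite ?rpredN//.
    by rewrite -opprB lm mulNrn.
  by apply: (npair k i) => //; exists m.
have [->//|s0] := posnP (size s).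
pose q0 := nth 0%N s 0; have sq0 : q0 \in s by exact: mem_nth.
(* A value of [cls] paired with a parity stands for a class in [M / 2M]. The classes of [s] and
   their translates by that of [q0] are disjoint, so twice the size of [s] is at most
   [2 * 2 ^ r]. *)
pose f1 q := (cls (l q), odd q).
pose f2 q := (cls (l q0 + l q), odd (q0 + q)).
have Ll0 q : l q0 + l q \in L by rewrite rpredD.
have ufs : uniq (map f1 s ++ map f2 s).
  rewrite cat_uniq; apply/and3P; split.
  - rewrite map_inj_in_uniq// => i k si sk [/(clsP _ _ (Ll _) (Ll _)) dik oik].
    by apply/eqP/negPn/negP => ik; exact: (pair i k).
  - apply/hasPn => _ /mapP[k sk ->]; apply/negP => /mapP[i si [+ oik]].
    move=> /(clsP _ _ (Ll0 _) (Ll _)) dik.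
    have dl q : double_in L (l q *+ 2) by exists (l q).
    (* A collision means that the classes of [q0], [k] and [i] sum to 0; if two of these indices
       agree, the class of the third vanishes and [nzero] applies. *)
    have [q0k|q0k] := eqVneq q0 k.
      apply: (nzero i) => //; last by rewrite -oik -q0k addnn odd_double.
      have := double_inB (dl k) dik.
      by rewrite q0k mulr2n opprB addrCA subrr addr0.
    have [q0i|q0i] := eqVneq q0 i.
      apply: (nzero k) => //; last by move: oik; rewrite q0i; lia.
      by move: dik; rewrite q0i addrAC subrr add0r.
    have [ki|ki] := eqVneq k i.
      apply: (nzero q0) => //; last by move: oik; rewrite ki; lia.
      by move: dik; rewrite ki addrK.
    apply: (triple [:: q0; k; i]) => //=.
    + by rewrite !inE negb_or q0k q0i ki.
    + by move=> q; rewrite !inE => /or3P[] /eqP->.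
    + rewrite !big_cons big_nil addr0.
      have dNl q : double_in L (- (l q *+ 2)).
        by exists (- l q); rewrite ?rpredN// mulNrn.
      have := double_inB dik (dNl i).
      by rewrite opprK mulr2n !addrA subrK.
    + by rewrite !big_cons big_nil addn0; lia.
  - rewrite map_inj_in_uniq// => i k si sk [/(clsP _ _ (Ll0 _) (Ll0 _)) + oik].
    rewrite opprD addrACA subrr add0r => dik.
    apply/eqP/negPn/negP => ik; apply: (pair i k) => //.
    by move: oik; rewrite !oddD => /addbI.
have := max_card (mem (map f1 s ++ map f2 s)).
rewrite (card_uniqP ufs) size_cat !size_map addnn card_prod card_bool -muln2.
by rewrite leq_pmul2r// => /leq_trans; exact.
Qed.
Lemma strict_argmin h : (0 < h)%N -> exists q, [/\ (0 < q)%N, (q <= h)%N,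
  strict_return alpha q & forall p, (0 < p)%N -> (p <= h)%N -> rho q <= rho p].
Proof.
elim: h => // -[|h] IH _.
  exists 1%N; split=> //; first by split=> // p; case: p.
  by move=> p p0 p1; have -> : p = 1%N by lia.
have [q [q0 qh retq qmin]] := IH isT.
have [lt|ge] := ltP (rho h.+2) (rho q).
  exists h.+2; split=> //.
    by split=> // p p0 ph; apply: lt_le_trans lt (qmin p p0 _).
  move=> p p0; rewrite leq_eqVlt => /predU1P[->//|ph].
  exact/ltW/(lt_le_trans lt)/qmin.
exists q; split=> //; first exact: leqW.
by move=> p p0; rewrite leq_eqVlt => /predU1P[->//|ph]; exact: qmin.
Qed.

(** A strict return [q] other than 1 and the first minimiser of [rho] below [q] would be two points,
    against the bound [2 ^ 0]. *)
Lemma strict_return_rank0 q : zrank (component_group L) = 0%N ->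
  strict_return alpha q -> q = 1%N.
Proof.
move=> r0 retq; have [q0 _] := retq; apply/eqP; apply: contraT => q1.
have [|p [p0 pq retp pmin]] := @strict_argmin q.-1; first by lia.
suff : (size [:: p; q] <= 2 ^ zrank (component_group L))%N by rewrite r0.
apply: strict_returns_card.
- by rewrite cons_uniq mem_seq1 andbT; lia.
- by move=> i; rewrite !inE => /orP[]/eqP->.
- by move=> i j k; rewrite !inE => /orP[]/eqP-> /orP[]/eqP-> /orP[]/eqP->; lia.
- move=> i d; rewrite !inE => /orP[]/eqP-> dpq d0; last by exfalso; lia.
  by apply: pmin => //; lia.
Qed.

(** * The best-return sequence and its growth *)

Lemma best_return_strict n q : best_return alpha n q -> strict_return alpha q.
Proof.
elim=> [|{}n p {}q _ [p0 IH] pq rpq pmin]; first by split=> // -[].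
split=> [|d d0 dq]; first exact: leq_trans pq.
have [dp|pd|->//] := ltngtP d p; first exact: lt_trans rpq (IH d d0 dp).
apply: (lt_le_trans rpq); rewrite leNgt; apply/negP => /(pmin d pd).
by rewrite leqNgt dq.
Qed.

(** The inductive predicate exposes one step at a time, while the counting argument needs a window
    of consecutive terms as a single function. *)
Lemma best_return_history n q : best_return alpha n q ->
  exists f : nat -> nat, f n = q /\ forall k, (0 < k <= n)%N ->
    best_return alpha k (f k) /\ ((k < n)%N -> (f k < f k.+1)%N /\
      forall p, (0 < p)%N -> (p < f k.+1)%N -> rho (f k) <= rho p).
Proof.
elim=> [|{}n p {}q bp [f [fn Hf]] pq rpq pmin].
  exists (fun=> 1%N); split=> // k k1; have -> : k = 1%N by lia.
  by split; [exact: best_return_first | rewrite ltnn].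
exists (fun k => if k == n.+1 then q else f k); rewrite eqxx; split=> // k.
move=> /andP[k0]; rewrite leq_eqVlt => /predU1P[->|kn].
  by rewrite eqxx ltnn; split=> //; exact: best_return_next bp pq rpq pmin.
rewrite (ltn_eqF kn) eqSS; have [|bk Hk] := Hf k; first by lia.
split=> // _; have [kE|kn'] := eqVneq k n; last by apply: Hk; lia.
rewrite kE fn; split=> // d d0 dq; have [_ retp] := best_return_strict bp.
have [dp|pd|->//] := ltngtP d p; first exact/ltW/retp.
by rewrite leNgt; apply/negP => /(pmin d pd); rewrite leqNgt dq.
Qed.

(** Were [q] smaller than the sum, the [2 ^ r + 1] terms from index [n] to [n + 2 ^ r] would violate
    the bound of [strict_returns_card]. *)
Lemma best_return_gap n q : (0 < n)%N ->
  best_return alpha (n + 2 ^ zrank (component_group L)) q ->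
  exists q0 q1, [/\ best_return alpha n q0, best_return alpha n.+1 q1 &
    (q0 + q1 <= q)%N].
Proof.
set K := (2 ^ _)%N => n0 bq.
have K0 : (0 < K)%N by rewrite expn_gt0.
have [f [fq Hf]] := best_return_history bq.
have bf k : (n <= k <= n + K)%N -> best_return alpha k (f k).
  by move=> kK; have [] // := Hf k; lia.
have fS k : (n <= k < n + K)%N -> (f k < f k.+1)%N.
  by move=> kK; have [|_ []] // := Hf k; lia.
have fmono i j : (n <= i)%N -> (i < j)%N -> (j <= n + K)%N -> (f i < f j)%N.
  move=> ni; elim: j => // j IH; rewrite ltnS leq_eqVlt => /predU1P[<-|ij] jK.
    by apply: fS; lia.
  by apply: ltn_trans (IH ij (ltnW jK)) _; apply: fS; lia.
have fle i j : (n <= i)%N -> (i <= j)%N -> (j <= n + K)%N -> (f i <= f j)%N.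
  move=> ni; rewrite leq_eqVlt => /predU1P[->//|ij jK].
  by apply/ltnW/fmono.
exists (f n), (f n.+1); split; [by apply: bf; lia | by apply: bf; lia |].
rewrite leqNgt -fq; apply/negP => qlt.
pose s := [seq f k | k <- iota n K.+1].
suff : (size s <= K)%N by rewrite size_map size_iota ltnn.
have sP i : i \in s -> exists2 k, (n <= k <= n + K)%N & i = f k.
  by move=> /mapP[k]; rewrite mem_iota => kK ->; exists k => //; lia.
apply: strict_returns_card.
- rewrite map_inj_in_uniq ?iota_uniq// => i j.
  rewrite !mem_iota => iK jK fij; case: (ltngtP i j) => // [ij|ji].
    by have := fmono i j; rewrite fij ltnn; lia.
  by have := fmono j i; rewrite fij ltnn; lia.
- by move=> _ /sP[k kK ->]; exact: best_return_strict (bf k kK).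
- move=> _ _ _ /sP[i iK ->] /sP[j jK ->] /sP[k kK ->] fij.
  apply: leq_ltn_trans (fle k (n + K)%N _ _ _) _; [lia|lia|lia|].
  apply: (leq_trans qlt); case: (ltngtP i j) => [ij|ji|ij].
  + by rewrite leq_add// fle//; lia.
  + by rewrite addnC leq_add// fle//; lia.
  + by rewrite ij eqxx in fij.
- move=> _ p /sP[i iK ->] /sP[j jK ijp] p0.
  have jle : (f j <= f (n + K))%N by apply: fle; lia.
  (* For [i = n], [qlt] gives [2p < f n.+1], and no return before [f n.+1] is closer than [f n]. For
     [i > n] it gives [2p < f n], so [p] precedes the strict return [f i]. *)
  have [iE|ni] := eqVneq i n.
    have [|_ [|_]] := Hf n; [lia|lia|]; rewrite iE; apply=> //.
    by move: qlt jle; rewrite -ijp iE; lia.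
  have [_ reti] := best_return_strict (bf i iK).
  apply/ltW/reti => //; have : (f n.+1 <= f i)%N by apply: fle; lia.
  have : (f n < f n.+1)%N by apply: fS; lia.
  by move: qlt jle; rewrite -ijp; lia.
Qed.
(** * Nearest-neighbour distances *)

Lemma orbit_segP N x :
  reflect (exists2 k, (k < N)%N & x = alpha *+ k) (x \in orbit_seg alpha N).
Proof.
rewrite mem_undup; apply: (iffP mapP) => -[k kN ->]; exists k => //.
  by move: kN; rewrite mem_iota.
by rewrite mem_iota.
Qed.

Lemma nn_distE N x y : y \in orbit_seg alpha N -> y != x ->
  (forall z, z \in orbit_seg alpha N -> z != x -> qdist x y <= qdist x z) ->
  nn_dist alpha N x = qdist x y.
Proof.
move=> yO yx ymin; apply/eqP; rewrite eq_le; apply/andP; split.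
  apply: ge_inf; last by exists y.
  by exists (qdist x y) => _ [z [zO zx] <-]; exact: ymin.
apply: lb_le_inf; first by exists (qdist x y), y.
by move=> _ [z [zO zx] <-]; exact: ymin.
Qed.

(** The orbit is then a whole finite cyclic group, and translation by [alpha *+ k] is an isometry of
    it. *)
Lemma nn_dist_periodic N m k : (0 < m < N)%N -> alpha *+ m = 0 ->
  nn_dist alpha N (alpha *+ k) = nn_dist alpha N 0.
Proof.
move=> /andP[m0 mN] am.
have orbitP x : x \in orbit_seg alpha N <-> exists j, x = alpha *+ j.
  split=> [/orbit_segP[j _ ->]|[j ->]]; first by exists j.
  apply/orbit_segP; exists (j %% m)%N; first by rewrite (ltn_trans (ltn_pmod _ _)).
  by rewrite {1}(divn_eq j m) mulrnDr mulnC mulrnA am mul0rn add0r.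
have oppE j : - (alpha *+ j) = alpha *+ (j * m.-1).
  apply/eqP; rewrite eq_sym -addr_eq0 -mulrnDr -mulnSr prednK//.
  by rewrite mulnC mulrnA am mul0rn.
congr inf; apply/seteqP; split=> _ [y [/orbitP[j ->] yx] <-].
  exists (alpha *+ j - alpha *+ k).
    split; last by rewrite subr_eq0.
    by apply/orbitP; exists (j + k * m.-1)%N; rewrite oppE mulrnDr.
  by rewrite /qdist sub0r opprB.
exists (alpha *+ j + alpha *+ k).
  split; last by rewrite -subr_eq0 addrK.
  by apply/orbitP; exists (j + k)%N; rewrite mulrnDr.
by rewrite /qdist sub0r opprD addrCA subrr addr0.
Qed.

(** The [N] points are distinct, and the index distances from [k] to the others are exactly the
    integers from 1 to [maxn k (N.-1 - k)]. *)
Lemma nn_dist_aperiodic N k q :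
  (forall m, (0 < m < N)%N -> alpha *+ m != 0) -> (k < N)%N ->
  (0 < q)%N -> (q <= maxn k (N.-1 - k))%N ->
  (forall p, (0 < p)%N -> (p <= maxn k (N.-1 - k))%N -> rho q <= rho p) ->
  nn_dist alpha N (alpha *+ k) = rho q.
Proof.
move=> aper kN q0 qH qmin.
have rhoE i j : qdist (alpha *+ i) (alpha *+ j) = rho ((i - j) + (j - i))%N.
  have [ij|/ltnW ji] := leqP i j.
    by rewrite qdist_multiples// (eqP ij) add0n.
  by rewrite qdistC qdist_multiples// (eqP ji) addn0.
have inj i j : (i < N)%N -> (j < N)%N -> i != j -> alpha *+ i != alpha *+ j.
  move=> iN jN; case: (ltngtP i j) => // [ij|ji] _.
    by rewrite eq_sym -subr_eq0 -mulrnBr ?(ltnW ij)//; apply: aper; lia.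
  by rewrite -subr_eq0 -mulrnBr ?(ltnW ji)//; apply: aper; lia.
have [j [jN jk qE]] : exists j, [/\ (j < N)%N, j != k & (k - j + (j - k))%N = q].
  have [qk|kq] := leqP q k; first by exists (k - q)%N; split; lia.
  by exists (k + q)%N; split; lia.
rewrite -qE -rhoE; apply: nn_distE.
- by apply/orbit_segP; exists j.
- exact: inj.
- move=> _ /orbit_segP[i iN ->] aik; rewrite !rhoE qE.
  have ik : i != k by apply: contraNneq aik => ->.
  by apply: qmin; lia.
Qed.

(** As [maxn k (N.-1 - k)] is at least [N./2], a minimiser not beyond [N./2] always yields the same
    value [rho q0], which accounts for the extra 1; any other one is a strict return in the listed
    interval. *)
Lemma nn_count_strict_returns N : (2 <= N)%N ->
  (nn_count alpha N <=
     (size [seq q <- iota N./2.+1 (N.-1 - N./2) | `[< strict_return alpha q >]]).+1)%N.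
Proof.
move=> N2; rewrite /nn_count; case: ifP => // _.
have size_undup_le (s t : seq R) : {subset s <= t} -> (size (undup s) <= size t)%N.
  move=> st; apply: uniq_leq_size (undup_uniq s) _ => x.
  by rewrite mem_undup; exact: st.
have [[m mN am]|aper] := pselect (exists2 m, (0 < m < N)%N & alpha *+ m = 0).
  apply: (@leq_trans 1) => //; apply: (size_undup_le _ [:: nn_dist alpha N 0]).
  move=> _ /mapP[_ /orbit_segP[k _ ->] ->].
  by rewrite (nn_dist_periodic k mN am) mem_head.
have [|q0 [q00 q0h _ q0min]] := @strict_argmin N./2; first by lia.
rewrite -(size_map rho) -/(size (rho q0 :: _)); apply: size_undup_le.
move=> _ /mapP[_ /orbit_segP[k kN ->] ->].
have [|q [q1 qH retq qmin]] := @strict_argmin (maxn k (N.-1 - k)); first by lia.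
rewrite (@nn_dist_aperiodic N k q)//; last first.
  by move=> m mN; apply/eqP => am; apply: aper; exists m.
have [qh|hq] := leqP q N./2.
  rewrite (_ : rho q = rho q0) ?mem_head//; apply/eqP; rewrite eq_le.
  by rewrite q0min// qmin//; lia.
rewrite inE; apply/orP; right; apply: map_f.
by rewrite mem_filter asboolT//= mem_iota; lia.
Qed.

(** Two returns beyond [N./2] sum to more than [N.-1], and half their difference is smaller than
    either of them. *)
Lemma nn_count_le N : (2 <= N)%N ->
  (nn_count alpha N <= 2 ^ zrank (component_group L) + 1)%N.
Proof.
move=> N2; apply: (leq_trans (nn_count_strict_returns N2)); rewrite addn1 ltnS.
apply: strict_returns_card => [|q|i j k|i p].
- by rewrite filter_uniq// iota_uniq.
- by rewrite mem_filter => /andP[/asboolP].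
- by rewrite !mem_filter !mem_iota => /andP[_ ?] /andP[_ ?] /andP[_ ?] _; lia.
- rewrite !mem_filter !mem_iota => /andP[/asboolP[_ reti] ?] /andP[_ ?] p0.
  by apply/ltW/reti => //; lia.
Qed.

Lemma nn_count_le_rank0 N : zrank (component_group L) = 0%N -> (2 <= N)%N ->
  (nn_count alpha N <= 1)%N.
Proof.
move=> r0 N2; apply: (leq_trans (nn_count_strict_returns N2)); rewrite ltnS.
rewrite leqn0 size_eq0 -[_ == _]negbK -has_filter; apply/hasPn => q.
rewrite mem_iota => qN; apply/negP => /asboolP /(strict_return_rank0 r0) q1.
by move: qN; rewrite q1; lia.
Qed.

End Returns.

Theorem proposition1 (R : realType) (V : finInnerProductType R)
    (L : zmodClosed V) (closedL : closed [set` L]) (alpha : {quot L}) :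
  let r := zrank (component_group L) in
  ((1 <= r)%N ->
     (forall n q : nat, (1 <= n)%N -> best_return alpha (n + 2 ^ r) q ->
        exists q0 q1 : nat,
          [/\ best_return alpha n q0, best_return alpha n.+1 q1
            & (q0 + q1 <= q)%N]) /\
     (forall N : nat, (2 <= N)%N -> (nn_count alpha N <= 2 ^ r + 1)%N)) /\
  (r = 0%N ->
     (forall n q : nat, best_return alpha n q -> n = 1%N) /\
     (forall N : nat, (2 <= N)%N -> (nn_count alpha N <= 1)%N)).
Proof.
move=> r; split=> [_|r0]; split.
- by move=> n q; exact: best_return_gap.
- by move=> N; exact: nn_count_le.
- move=> n q bq; have q1 := strict_return_rank0 closedL r0 (best_return_strict bq).
  (* A term of index above 1 exceeds an earlier positive term, so it cannot be 1. *)
  move: q1; case: bq => // {}n p {}q bp pq _ _ q1.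
  by have [p0 _] := best_return_strict bp; lia.
- by move=> N; exact: nn_count_le_rank0.
Qed.
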